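(* Let $\alpha',\alpha\ge1$ be integers, let $\alpha_o'\in\{1,\dots,\alpha'\}$ and $\alpha_o\in\{1,\dots,\alpha\}$, and let $p',p\in(0,1)$. Let $H(\bar\omega)=T'(\omega')\circ T(\omega)$ be the random horocyclic product of the percolation subtrees $T'(\omega')$ (with minimal and maximal numbers of offspring $\alpha_o',\alpha'$ and retention parameter $p'$) and $T(\omega)$ (with minimal and maximal numbers of offspring $\alpha_o,\alpha$ and retention parameter $p$). Suppose that the supports of the two offspring measures intersect, i.e. $$\{\alpha_o',\dots,\alpha'\}\cap\{\alpha_o,\dots,\alpha\}\neq\emptyset.$$ Then $H(\bar\omega)|C_{\bar o}(\bar\omega)$ is $\bar\mu$-almost surely amenable, where $C_{\bar o}(\bar\omega)$ is the connected component of $H(\bar\omega)$ containing the root $\bar o$.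
   Context: **Trees with a fixed end.** Let $\mathcal T'$ and $\mathcal T$ be homogeneous trees of degree $\alpha'+1$ and $\alpha+1$, with fixed roots $o',o$ and fixed ends $\gamma',\gamma$. (An end is an equivalence class of rays, i.e. infinite paths without repeated vertices; two rays in a tree are equivalent if their traces differ by only finitely many vertices.) For a vertex $x$ of $\mathcal T$, let $c$ be the confluent of $x$ and $o$ with respect to $\gamma$, i.e. the first common vertex of the rays from $x$ to $\gamma$ and from $o$ to $\gamma$. The Busemann function (level) is $\mathbf h(x)=d(x,c)-d(c,o)$. The function $\mathbf h'$ on $\mathcal T'$ is defined analogously. Each vertex $x$ of $\mathcal T$ has one neighbour (parent) at level $\mathbf h(x)-1$ and $\alpha$ neighbours (children) at level $\mathbf h(x)+1$; similarly in $\mathcal T'$ with $\alpha'$ children. **Horocyclic product.** The Diestel-Leader graph $G=\mathcal T'\circ\mathcal T=DL_{\alpha',\alpha}$ has vertex set $V=\{\langle k',k\rangle\in V(\mathcal T')\times V(\mathcal T): \mathbf h'(k')=-\mathbf h(k)\}$. Its edges are the pairs $\{\langle k',k\rangle,\langle l',l\rangle\}\subset V$ with $k'\sim l'$ in $\mathcal T'$ and $k\sim l$ in $\mathcal T$. The root is $\bar o=\langle o',o\rangle$. **Percolation.** At each vertex of $\mathcal T$, number the $\alpha$ edges to its children by $1,\dots,\alpha$. Edges with number at most $\alpha_o$ are unmarked, the others are marked. Do the same in $\mathcal T'$ with $\alpha',\alpha_o'$. Under $\mu$ (for $\omega\in\Omega=2^{E(\mathcal T)}$), all unmarked edges of $\mathcal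 T$ are open, and the marked edges are open independently with probability $p$ each. Under $\mu'$ (for $\omega'\in\Omega'=2^{E(\mathcal T')}$) the same holds in $\mathcal T'$ with $p'$. Let $\bar\mu=\mu'\otimes\mu$ on $\Omega'\times\Omega$, and $\bar\omega=\langle\omega',\omega\rangle$. $T'(\omega')$ and $T(\omega)$ denote the random subgraphs of open edges; the number of offspring of a vertex is its number of open edges to children, so the offspring measures are supported on $\{\alpha_o',\dots,\alpha'\}$ and $\{\alpha_o,\dots,\alpha\}$ respectively. $H(\bar\omega)=T'(\omega')\circ T(\omega)$ is the subgraph of $G$ with vertex set $V$ in which an edge $\{\langle k',k\rangle,\langle l',l\rangle\}$ of $G$ is retained if and only if both $\{k',l'\}$ and $\{k,l\}$ are open. $H|C$ is the subgraph of $H$ induced by $C$. **Amenability.** A graph $\Gamma$ is amenable if $\inf |\partial_\Gamma C|/|C|=0$, the infimum being over all finite nonempty subsets $C\subset V(\Gamma)$, where $\partial_\Gamma C$ is the set of vertices of $\Gamma$ outside $C$ having a neighbour (in $\Gamma$) in $C$. In particular, a finite graph is amenable. *)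

(* Defs.v *)
From mathcomp Require Import all_boot all_order all_algebra finmap.
From mathcomp Require Import all_classical all_reals all_analysis.

Set Implicit Arguments.
Unset Strict Implicit.
Unset Printing Implicit Defensive.

Import Order.TTheory GRing.Theory Num.Theory.

Local Open Scope classical_set_scope.
Local Open Scope fset_scope.
Local Open Scope ring_scope.

Record graph := Graph {
  vertex :> choiceType;
  adj : rel vertex;
  adj_sym : symmetric adj;
  adj_irr : irreflexive adj }.

Definition edge (G : graph) : choiceType :=
  {A : {fset G} | `[< exists x y : G, adj x y /\ A = [fset x; y] >]}.

Section GraphNotions.
Variable G : graph.

Definition component (x : G) : set G :=
  [set y | exists p : seq G, path (@adj G) x p /\ last x p = y].

Definition connected_graph : Prop := forall x : G, component x = setT.

(* A pair of adjacent vertices is a [ucycle] of length 2, hence the bound 3. *)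
Definition acyclic_graph : Prop :=
  forall c : seq G, ucycle (@adj G) c -> (size c < 3)%N.

Definition regular_graph (d : nat) : Prop :=
  forall x : G, ([set y | adj x y] #= `I_d)%card.

Definition walk_of_length (x y : G) (n : nat) : Prop :=
  exists p : seq G, [/\ path (@adj G) x p, last x p = y & size p = n].

(* The default value 0 is only taken when x and y are not connected. *)
Definition dist (x y : G) : nat :=
  xget 0%N [set n | walk_of_length x y n /\
                    forall m, walk_of_length x y m -> (n <= m)%N].

Definition ray (r : nat -> G) : Prop :=
  injective r /\ forall n, adj (r n) (r n.+1).

Definition ray_equiv (r s : nat -> G) : Prop :=
  finite_set (range r `+` range s).

Definition is_end (g : set (nat -> G)) : Prop :=
  exists r, ray r /\ g = [set s | ray s /\ ray_equiv r s].

Definition is_confluent (g : set (nat -> G)) (x y c : G) : Prop :=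
  exists (r s : nat -> G) (i j : nat),
    [/\ g r /\ r 0%N = x, g s /\ s 0%N = y, r i = c /\ s j = c,
        forall k, (k < i)%N -> ~ range s (r k) &
        forall k, (k < j)%N -> ~ range r (s k)].

(* In a tree with end g the confluent exists and is unique, so that the
   default value x is not used. *)
Definition confluent (g : set (nat -> G)) (x y : G) : G :=
  xget x (is_confluent g x y).

Definition boundary (C : set G) : set G :=
  [set y | ~ C y /\ exists2 x, C x & adj x y].

Definition amenable (R : realType) : Prop :=
  ereal_inf [set (counting (boundary C) / counting C : \bar R)%E
            | C in [set C : set G | finite_set C /\ C !=set0]] = 0%E.

Lemma induced_subgraph_subproof (C : set G) :
  symmetric (fun x y : C => adj (val x) (val y)) /\
  irreflexive (fun x y : C => adj (val x) (val y)).
Proof. by split=> [x y|x]; [exact: adj_sym|exact: adj_irr]. Qed.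

Definition induced_subgraph (C : set G) : graph :=
  Graph (proj1 (induced_subgraph_subproof C))
        (proj2 (induced_subgraph_subproof C)).

Lemma open_graph_subproof (w : edge G -> bool) :
  let e (x y : G) :=
    `[< exists f : edge G, val f = [fset x; y] /\ w f >] in
  symmetric e /\ irreflexive e.
Proof.
split=> [x y|x]; first by rewrite /= fsetUC.
apply/asboolP => -[[A /= /asboolP[y [z [yz EA]]]] [Exx _]].
have Hy : y \in [fset x; x] by rewrite -Exx EA !inE eqxx.
have Hz : z \in [fset x; x] by rewrite -Exx EA !inE eqxx orbT.
move: Hy Hz yz; rewrite !inE !orbb => /eqP-> /eqP->.
by rewrite adj_irr.
Qed.

Definition open_graph (w : edge G -> bool) : graph :=
  Graph (proj1 (open_graph_subproof w)) (proj2 (open_graph_subproof w)).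

End GraphNotions.

Arguments dist {G}.
Arguments component {G}.

(* Homogeneous tree of degree a + 1 with a root and a fixed end. *)
Record ended_tree (a : nat) := EndedTree {
  tree_graph :> graph;
  tree_connected : connected_graph tree_graph;
  tree_acyclic : acyclic_graph tree_graph;
  tree_regular : regular_graph tree_graph a.+1;
  tree_root : tree_graph;
  tree_end : set (nat -> tree_graph);
  tree_endP : is_end tree_end }.

Arguments tree_root {a}.
Arguments tree_end {a}.

Section EndedTree.
Variables (a : nat) (T : ended_tree a).

Definition level (x : T) : int :=
  let c := confluent (tree_end T) x (tree_root T) in
  (dist x c)%:Z - (dist c (tree_root T))%:Z.

Definition child (x y : T) : Prop := adj x y /\ level y = level x + 1.

Definition child_edges (x : T) : set (edge T) :=
  [set f | exists2 y, child x y & val f = [fset x; y]].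

Definition is_numbering (num : edge T -> nat) : Prop :=
  forall x : T, set_bij (child_edges x) [set n | (1 <= n <= a)%N] num.

Lemma level_root : level (tree_root T) = 0.
Proof.
rewrite /level; suff -> : confluent (tree_end T) (tree_root T) (tree_root T)
    = tree_root T by rewrite subrr.
rewrite /confluent; case: xgetP => // c _ [r [s [i [j]]]].
move=> [[_ r0] [_ s0] [ri _] rs _].
case: i ri rs => [<- //|i] _ /(_ 0%N isT); rewrite r0 -s0; case.
by exists 0%N.
Qed.

End EndedTree.

Section HorocyclicProduct.
Variables (X' X : graph) (h' : X' -> int) (h : X -> int).

Let hvertex : choiceType := {v : X' * X | h' v.1 == - h v.2}.

Let hadj : rel hvertex := fun v w =>
  adj (val v).1 (val w).1 && adj (val v).2 (val w).2.

Lemma horocyclic_subproof : symmetric hadj /\ irreflexive hadj.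
Proof.
split=> [v w|v]; last by rewrite /hadj adj_irr.
by rewrite /hadj adj_sym [X in _ && X]adj_sym.
Qed.

Definition horocyclic : graph :=
  Graph (proj1 horocyclic_subproof) (proj2 horocyclic_subproof).

End HorocyclicProduct.

Section DiestelLeader.
Variables (a' a : nat) (T' : ended_tree a') (T : ended_tree a).

Definition DL : graph := @horocyclic T' T (@level _ T') (@level _ T).

Lemma DL_root_subproof :
  level (tree_root T') == - level (tree_root T).
Proof. by rewrite !level_root oppr0. Qed.

Definition DL_root : DL :=
  exist _ (tree_root T', tree_root T) DL_root_subproof.

(* Percolation only removes edges: the vertices and levels are those of DL. *)
Definition DL_open (w' : edge T' -> bool) (w : edge T -> bool) : graph :=
  @horocyclic (open_graph w') (open_graph w) (@level _ T') (@level _ T).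

End DiestelLeader.

Definition coordinate_events (I : choiceType) : set_system (I -> bool) :=
  [set [set w : I -> bool | w i] | i in [set: I]].

(* 2^I with its product sigma-algebra. *)
Definition config (I : choiceType) := g_sigma_algebraType (@coordinate_events I).

Section Percolation.
Variable R : realType.

(* The infinite product of the nu i: the unique probability measure on 2^I
   with the prescribed values on finite-dimensional boxes. *)
Definition is_product_measure (I : choiceType) (nu : I -> probability bool R)
    (mu : probability (config I) R) : Prop :=
  forall (F : {fset I}) (A : I -> set bool),
    mu [set w | forall i, i \in F -> A i (w i)]
    = (\prod_(i <- F) nu i (A i))%E.

(* Retention probability 1 encodes that unmarked edges are always open. *)
Definition is_percolation (a : nat) (T : ended_tree a) (num : edge T -> nat)
    (ao : nat) (p : R) (mu : probability (config (edge T)) R) : Prop :=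
  is_product_measure
    (fun f => bernoulli_prob (if (num f <= ao)%N then 1 else p)) mu.

End Percolation.

(* Main.v *)
Require Import Defs.
From mathcomp Require Import all_boot all_order all_algebra finmap.
From mathcomp Require Import all_classical all_reals all_analysis.
From mathcomp Require Import zify lra.

(* Let k lie in both supports. If below r' and r the first n open generations are
   exactly k-ary and the levels of r' and r differ by n as required, then the
   horocyclic product of these two finite trees is a connected "tetrahedron"
   with (n+1) k^n vertices, all of whose outer neighbours lie next to its two
   extreme layers, hence number at most k^n (a' + a).
   If the edges from both roots upwards are each cut at some ancestor, the
   component of the root is finite. Otherwise, say that all edges above o' are
   open: then the component contains the pairs formed by the j-th ancestor of o'
   and the j-th vertex of the line of first children of o. Tetrahedra located
   along these two lines at levels spaced by n depend on disjoint sets of edges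
   and occur with probability bounded below, so almost surely one of them occurs.
   No conditioning on the ancestor line being open is needed: when it is
   incompatible with these tetrahedra, it almost surely is not open. *)

Set Implicit Arguments.
Unset Strict Implicit.
Unset Printing Implicit Defensive.

Import Order.TTheory GRing.Theory Num.Theory.

Local Open Scope classical_set_scope.
Local Open Scope ring_scope.

(** * Rays and levels in a tree with a fixed end *)

Definition reach (T : Type) (e : rel T) (x y : T) : Prop :=
  exists p : seq T, path e x p /\ last x p = y.

Section Reach.
Variables (T : eqType) (e : rel T).

Lemma reach_refl x : reach e x x.
Proof. by exists [::]. Qed.

Lemma reach1 x y : e x y -> reach e x y.
Proof. by move=> xy; exists [:: y] => /=; rewrite xy. Qed.

Lemma reach_trans y x z : reach e x y -> reach e y z -> reach e x z.
Proof.
move=> [p [xp <-]] [q [pq <-]]; exists (p ++ q).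
by rewrite cat_path last_cat xp pq.
Qed.

Lemma reach_sym x y : symmetric e -> reach e x y -> reach e y x.
Proof.
move=> sym_e [p [xp <-]]; exists (rev (belast x p)); split.
  by rewrite rev_path (eq_path (e' := e)).
by case: p {xp} => //= z p; rewrite rev_cons last_rcons.
Qed.

End Reach.

(** * Simple paths and rays in acyclic graphs *)

Section AcyclicGraph.
Variable G : graph.
Hypothesis acyclicG : acyclic_graph G.

(** If [u] and [v] were distinct, a simple path extracted from [p] would close up through [x] to a
    cycle of length at least 3. *)
Lemma acyclic_neighbours (x u v : G) (p : seq G) :
  adj x u -> adj x v -> path (@adj G) u p -> last u p = v ->
  x \notin u :: p -> u = v.
Proof.
move=> xu xv /shortenP[q uq uniq_q sub_q] eqv xp.
apply/eqP; apply: contraT => neq_uv.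
have /acyclicG : ucycle (@adj G) [:: x, u & q].
  rewrite /ucycle /= rcons_path xu uq eqv adj_sym xv /=.
  move: uniq_q => /= ->; rewrite andbT.
  by apply: contra xp; rewrite !inE => /orP[->//|/sub_q ->]; rewrite orbT.
by case: q {uq uniq_q sub_q} eqv neq_uv => //= ->; rewrite eqxx.
Qed.

(** Induction along the paths: one tail followed by the other one reversed joins the two neighbours
    of [x] and avoids [x], so these neighbours agree. *)
Lemma acyclic_path_inj (x : G) (p q : seq G) :
  path (@adj G) x p -> path (@adj G) x q -> uniq (x :: p) -> uniq (x :: q) ->
  last x p = last x q -> p = q.
Proof.
elim: p x q => [|u p IH] x [|v q] //=.
- by move=> _ _ _ /andP[xq _] E; rewrite E mem_last in xq.
- by move=> _ _ /andP[xp _] _ E; rewrite -E mem_last in xp.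
move=> /andP[xu up] /andP[xv vq] /andP[xup uu] /andP[xvq uv] E.
suff uv' : u = v.
  by rewrite -uv' in vq uv E *; rewrite (IH u q).
apply: (@acyclic_neighbours x u v (p ++ rev (belast v q))) => //.
- rewrite cat_path up /= E rev_path (eq_path (e' := @adj G)) // => ? ?.
  by rewrite adj_sym.
- by rewrite last_cat E; case: (q) => //= w r; rewrite rev_cons last_rcons.
- rewrite -cat_cons mem_cat negb_or xup mem_rev.
  by apply: contra xvq; exact: mem_belast.
Qed.

(** Every walk between the two ends contains a simple path, which can only be [p]; hence no walk is
    shorter. *)
Lemma acyclic_dist (x : G) (p : seq G) :
  path (@adj G) x p -> uniq (x :: p) -> dist x (last x p) = size p.
Proof.
move=> xp up; rewrite /dist; case: xgetP => [n -> [[q [xq eq_last <-]] min]|none].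
  apply/eqP; rewrite eqn_leq min ?andTb; last by exists p.
  case/shortenP: xq eq_last {min} => r xr ur sub_r.
  move=> /(acyclic_path_inj xr xp ur up) <-.
  by apply: uniq_leq_size sub_r; case/andP: ur.
(* A shortest walk exists, so [dist] does not take its default value. *)
have walk_p : walk_of_length x (last x p) (size p) by exists p.
have ex_walk : exists n, `[< walk_of_length x (last x p) n >].
  by exists (size p); apply/asboolP.
case: (ex_minnP ex_walk) => n /asboolP walk_n min_n.
by case: (none n); split => // m walk_m; apply: min_n; apply/asboolP.
Qed.

Lemma ray_path (r : nat -> G) (n m : nat) : ray r ->
  path (@adj G) (r n) [seq r i | i <- iota n.+1 m]
  /\ uniq (r n :: [seq r i | i <- iota n.+1 m]).
Proof.
move=> [inj_r adj_r]; split.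
  by elim: m n => //= m IH n; rewrite adj_r IH.
by rewrite -map_cons map_inj_uniq // -[_ :: _]/(iota n m.+1) iota_uniq.
Qed.

Lemma last_map_iota (r : nat -> G) (n m : nat) :
  last (r n) [seq r i | i <- iota n.+1 m] = r (n + m)%N.
Proof.
elim: m n => [|m IH] n /=; first by rewrite addn0.
by rewrite IH addSnnS.
Qed.

Lemma ray_dist (r : nat -> G) (n m : nat) : ray r -> dist (r n) (r (n + m)%N) = m.
Proof.
move=> ray_r; have [pr ur] := ray_path n m ray_r.
by rewrite -last_map_iota acyclic_dist // size_map size_iota.
Qed.

Lemma ray_dist_sym (r : nat -> G) (n m : nat) :
  ray r -> dist (r (n + m)%N) (r n) = m.
Proof.
move=> ray_r; have [pr ur] := ray_path n m ray_r.
set p := [seq r i | i <- iota n.+1 m] in pr ur.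
have lp : last (r n) p = r (n + m)%N by exact: last_map_iota.
have lq : last (r (n + m)%N) (rev (belast (r n) p)) = r n.
  by rewrite -lp; case: (p) => //= z q; rewrite rev_cons last_rcons.
rewrite -lq acyclic_dist ?size_rev ?size_belast ?size_map ?size_iota //.
  by rewrite -lp rev_path (eq_path (e' := @adj G)) // => ? ?; rewrite adj_sym.
rewrite -rev_rcons -lp -lastI rev_uniq //.
Qed.

Lemma ray_shift (r : nat -> G) (n : nat) : ray r -> ray (fun i => r (i + n)%N).
Proof.
by move=> [inj_r adj_r]; split=> [i j /inj_r /addIn|i] //; rewrite addSn.
Qed.

(** An occurrence of [y] on [r] beyond index 1 would give a second simple path from [r 0] to [y],
    besides the edge. *)
Lemma ray_cons (r : nat -> G) (y : G) : ray r -> adj y (r 0%N) -> y <> r 1%N ->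
  ray (fun i => if i is j.+1 then r j else y).
Proof.
move=> ray_r yr0 yr1; have [inj_r adj_r] := ray_r.
have yr n : y <> r n.
  case: n => [yr|[//|n] yr]; first by rewrite yr adj_irr in yr0.
  have [pr ur] := ray_path 0 n.+2 ray_r.
  suff : [:: y] = [seq r i | i <- iota 1 n.+2] by [].
  apply: (@acyclic_path_inj (r 0%N)) => //=.
  - by rewrite adj_sym yr0.
  - by rewrite inE andbT; apply: contraTN yr0 => /eqP ->; rewrite adj_irr.
  - by rewrite (last_map_iota r 2) yr !addSn add0n.
split=> [[|i] [|j]|[|i]] //=.
- by move=> /yr.
- by move=> /esym /yr.
- by move=> /inj_r ->.
Qed.

Lemma ray_meet_eq (r s : nat -> G) (i j : nat) : ray r -> ray s ->
  r 0%N = s 0%N -> r i = s j -> i = j.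
Proof.
move=> ray_r ray_s rs0 rs.
have [pr ur] := ray_path 0 i ray_r; have [ps us] := ray_path 0 j ray_s.
rewrite -rs0 in ps us.
suff /(congr1 size) : [seq r l | l <- iota 1 i] = [seq s l | l <- iota 1 j].
  by rewrite !size_map !size_iota.
apply: acyclic_path_inj pr ps ur us _.
by rewrite last_map_iota rs0 last_map_iota !add0n.
Qed.

Lemma ray_meet_prefix (r s : nat -> G) (i k : nat) : ray r -> ray s ->
  r 0%N = s 0%N -> r i = s i -> (k <= i)%N -> r k = s k.
Proof.
move=> ray_r ray_s rs0 rs ki.
have [pr ur] := ray_path 0 i ray_r; have [ps us] := ray_path 0 i ray_s.
rewrite -rs0 in ps us.
have : [seq r l | l <- iota 1 i] = [seq s l | l <- iota 1 i].
  apply: acyclic_path_inj pr ps ur us _.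
  by rewrite last_map_iota rs0 last_map_iota !add0n.
case: k ki => // k ki /(congr1 (nth (r 0%N) ^~ k)).
by rewrite !(nth_map 0%N) ?size_iota // nth_iota // add1n.
Qed.

End AcyclicGraph.

Section RayEquivalence.
Variable G : graph.
Implicit Types r s t : nat -> G.

Lemma ray_equiv_sym r s : ray_equiv r s -> ray_equiv s r.
Proof. by rewrite /ray_equiv setYC. Qed.

Lemma ray_equiv_trans s r t : ray_equiv r s -> ray_equiv s t -> ray_equiv r t.
Proof.
move=> rs st.
have fin : finite_set ((range r `+` range s) `|` (range s `+` range t)).
  by rewrite finite_setU.
apply: sub_finite_set fin => x [] [xA xB]; case: (pselect (range s x)) => xs.
- by right; left.
- by left; left.
- by left; right.
- by right; right.
Qed.

Lemma ray_equiv_cofinal r s : ray r -> ray_equiv r s ->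
  exists n, forall m, (n <= m)%N -> range s (r m).
Proof.
move=> [inj_r _] fin.
have : finite_set [set i | ~ range s (r i)].
  have fin' : finite_set (range r `\` range s).
    by apply: sub_finite_set fin => x ?; left.
  apply: (sub_finite_set _ (finite_preimage (f := r) _ fin')).
    by move=> i /= ?; split => //; exists i.
  by move=> i j _ _; apply: inj_r.
move=> /finite_seqP[l lE]; exists (\max_(i <- l) i).+1 => m ml.
apply: contrapT => nsm; have : m \in l by have : [set` l] m by rewrite -lE.
by move=> lm; have := @leq_bigmax_seq _ l xpredT id m lm isT; rewrite leqNgt ml.
Qed.

Lemma ray_equiv_shift r n : ray_equiv r (fun i => r (i + n)%N).
Proof.
apply: (@sub_finite_set _ _ [set` [seq r i | i <- iota 0 n]]) => // x [] [[i _ <-] ni].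
  apply/mapP; exists i => //; rewrite mem_iota /= add0n ltnNge.
  by apply/negP => ni'; apply: ni; exists (i - n)%N => //; rewrite subnK.
by case: ni; exists (i + n)%N.
Qed.

Lemma ray_equiv_cons r y :
  ray_equiv r (fun i => if i is j.+1 then r j else y).
Proof.
apply: ray_equiv_sym.
have := ray_equiv_shift (fun i => if i is j.+1 then r j else y) 1.
by congr ray_equiv; apply/funext => i; rewrite addn1.
Qed.

End RayEquivalence.

(** * Rays to a fixed end *)

Section EndRays.
Variables (G : graph) (g : set (nat -> G)).
Hypotheses (connectedG : connected_graph G) (acyclicG : acyclic_graph G).
Hypothesis end_g : is_end g.

Lemma end_ray r : g r -> ray r.
Proof. by case: end_g => r0 [_ ->] []. Qed.

Lemma end_ray_equiv r s : g r -> g s -> ray_equiv r s.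
Proof.
case: end_g => r0 [_ ->] [_ r0r] [_ r0s].
by apply: ray_equiv_trans r0s; apply: ray_equiv_sym.
Qed.

Lemma end_closed r s : g r -> ray s -> ray_equiv r s -> g s.
Proof.
case: end_g => r0 [_ ->] [_ r0r] ray_s rs.
by split => //; apply: ray_equiv_trans rs.
Qed.

(** Start from any ray of the end and move its origin along a path to [x]: each edge either drops
    the first vertex of the ray or prepends a new one. *)
Lemma end_ray_from x : exists r, g r /\ r 0%N = x.
Proof.
have [r [ray_r gE]] := end_g.
have gr : g r by rewrite gE; split => //; rewrite /ray_equiv setYK.
have [p [rp <-]] : component (r 0%N) x by rewrite connectedG.
elim: p r {ray_r gE} gr rp => [|z p IH] s gs /=; first by exists s.
move=> /andP[sz zp]; suff [r gr rz] : exists2 r, g r & r 0%N = z.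
  by rewrite -rz in zp *; exact: IH zp.
have [zs1|zs1] := pselect (z = s 1%N).
  exists (fun i => s (i + 1)%N) => //.
  by apply: end_closed (ray_equiv_shift _ _) => //; apply/ray_shift/end_ray.
exists (fun i => if i is j.+1 then s j else z) => //.
apply: end_closed (ray_equiv_cons _ _) => //.
by apply: ray_cons => //; [apply: end_ray|rewrite adj_sym].
Qed.

(** The rays meet arbitrarily far out, always at equal indices, and each meeting forces agreement
    before it. *)
Lemma end_ray_uniq r s : g r -> g s -> r 0%N = s 0%N -> r = s.
Proof.
move=> gr gs rs0; apply/funext => k.
have [n nP] := ray_equiv_cofinal (end_ray gr) (end_ray_equiv gr gs).
have [j _ sj] := nP (maxn n k) (leq_maxl _ _).
have jE := ray_meet_eq acyclicG (end_ray gr) (end_ray gs) rs0 (esym sj).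
apply: (ray_meet_prefix acyclicG (end_ray gr) (end_ray gs) rs0 (i := maxn n k)).
  by rewrite jE in sj *.
exact: leq_maxr.
Qed.

Definition end_path x : nat -> G := sval (cid (end_ray_from x)).

Lemma end_path_end x : g (end_path x).
Proof. by rewrite /end_path; case: cid => r []. Qed.

Lemma end_path0 x : end_path x 0%N = x.
Proof. by rewrite /end_path; case: cid => r []. Qed.

Lemma end_pathE r : g r -> r = end_path (r 0%N).
Proof.
by move=> gr; apply: end_ray_uniq => //; [exact: end_path_end|rewrite end_path0].
Qed.

Lemma end_path_shift x n i : end_path (end_path x n) i = end_path x (i + n)%N.
Proof.
have gs : g (fun j => end_path x (j + n)%N).
  apply: end_closed (ray_equiv_shift _ _); first exact: end_path_end.
  exact/ray_shift/end_ray/end_path_end.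
by have /= := end_pathE gs => /(congr1 (fun f => f i)) <-.
Qed.

(** A neighbour [y] that is not the next vertex on the ray from [x] can be put in front of this ray,
    which then is the ray from [y]. *)
Lemma adj_end_path x y :
  adj x y = (y == end_path x 1%N) || (x == end_path y 1%N).
Proof.
have adj1 z : adj z (end_path z 1%N).
  have [_ /(_ 0%N)] := end_ray (end_path_end z); by rewrite end_path0.
apply/idP/orP => [xy|[/eqP ->|/eqP ->]]; [|exact: adj1|by rewrite adj_sym].
have [->|/eqP yx1] := eqVneq y (end_path x 1%N); first by left.
right; set r := fun i => if i is j.+1 then end_path x j else y.
have gr : g r.
  apply: end_closed (ray_equiv_cons _ _); first exact: end_path_end.
  apply: ray_cons => //; first exact/end_ray/end_path_end.
  by rewrite end_path0 adj_sym.
by have := end_pathE gr => /(congr1 (fun f => f 1%N)) /= <-; rewrite end_path0.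
Qed.

Lemma end_path_meet x y : exists i j, end_path x i = end_path y j.
Proof.
have [n /(_ n (leqnn _))[j _ E]] := ray_equiv_cofinal
  (end_ray (end_path_end x)) (end_ray_equiv (end_path_end x) (end_path_end y)).
by exists n, j.
Qed.

Lemma end_path_inj x : injective (end_path x).
Proof. by case: (end_ray (end_path_end x)). Qed.

(** Rays to the end coincide once they meet, so the difference of the two indices is the same at all
    common vertices. Levels can thus be computed from any common vertex, not only from the
    confluent. *)
Lemma end_path_meet_index x y i j i' j' :
  end_path x i = end_path y j -> end_path x i' = end_path y j' ->
  (i + j' = i' + j)%N.
Proof.
wlog ii' : i j i' j' / (i <= i')%N => [H|] E E'.
  by case/orP: (leq_total i i') => ?; [apply: H|apply/esym; apply: H].
have := end_path_shift x i (i' - i); rewrite subnK // E E' end_path_shift.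
by move=> /end_path_inj <-; rewrite addnA subnKC.
Qed.

Lemma confluent_dist x y : exists i j,
  [/\ end_path x i = end_path y j,
      dist x (confluent g x y) = i & dist (confluent g x y) y = j].
Proof.
rewrite /confluent; case: xgetP => [c _|none].
  move=> [r [s [i [j [[gr r0] [gs s0] [ri sj] _ _]]]]].
  exists i, j; split.
  - by rewrite -r0 -s0 -!end_pathE // ri.
  - by rewrite -r0 -ri -{2}[i]add0n ray_dist //; exact: end_ray.
  - by rewrite -s0 -sj -{1}[j]add0n ray_dist_sym //; exact: end_ray.
(* The first vertex of the ray from [x] that lies on the ray from [y] is a confluent, which excludes
   the default value of [confluent]. *)
have ex_meet : exists i, `[< range (end_path y) (end_path x i) >].
  by have [i [j ij]] := end_path_meet x y; exists i; apply/asboolP; exists j.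
case: (ex_minnP ex_meet) => i /asboolP[j _ ji] min_i.
case: (none (end_path x i)); exists (end_path x), (end_path y), i, j; split => //.
- by split; [exact: end_path_end|exact: end_path0].
- by split; [exact: end_path_end|exact: end_path0].
- move=> k ki /asboolP /min_i; by rewrite leqNgt ki.
(* By the constant index difference, an earlier meeting along the ray from [y] would also be an
   earlier one along the ray from [x]. *)
- move=> k kj [l _ lk].
  have := end_path_meet_index (esym ji) lk.
  have /min_i : `[< range (end_path y) (end_path x l) >] by apply/asboolP; exists k.
  by lia.
Qed.

End EndRays.

Lemma ended_tree_parent (a : nat) (T : ended_tree a) : exists pi : T -> T,
  (forall x y, adj x y = (y == pi x) || (x == pi y)) /\
  (forall x, level (pi x) = level x - 1).
Proof.
have endT := tree_endP T.
pose path x := end_path (@tree_connected _ T) (@tree_acyclic _ T) endT x.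
exists (fun x => path x 1%N); split; first exact: adj_end_path.
have levelE x i j : path x i = path (tree_root T) j -> level x = i%:Z - j%:Z.
  move=> E; have [i' [j' [E' di dj]]] := confluent_dist
    (@tree_connected _ T) (@tree_acyclic _ T) endT x (tree_root T).
  by rewrite /level di dj; have := end_path_meet_index E E'; lia.
move=> x; have [i [j E]] := end_path_meet
    (@tree_connected _ T) (@tree_acyclic _ T) endT x (tree_root T).
have pathS y n m : path (path y n) m = path y (m + n)%N by exact: end_path_shift.
(* Advancing the common vertex by one makes its index along the ray from [x] positive, so that it
   also lies on the ray from the parent of [x]. *)
have E1 : path x i.+1 = path (tree_root T) j.+1.
  by rewrite -[i.+1]add1n -pathS [path x i]E pathS.
rewrite (levelE _ _ _ E1) (levelE (path x 1%N) i j.+1); first by lia.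
by rewrite pathS addn1.
Qed.

(** * Parents, children and descendants *)

(** The combinatorial data of the tree from which tetrahedra are built. [rank x] stands for the
    number of the edge from [x] to its parent; [child_at] is meaningful only for indices from 1 to
    [a]. *)
Record genealogy (a : nat) (V : choiceType) (lev : V -> int) := Genealogy {
  parent : V -> V;
  rank : V -> nat;
  child_at : V -> nat -> V;
  lev_parent : forall x, lev (parent x) = lev x - 1;
  rank_bounds : forall x, (1 <= rank x <= a)%N;
  child_at_rank : forall x, child_at (parent x) (rank x) = x;
  parent_child_at : forall x i, (1 <= i <= a)%N -> parent (child_at x i) = x;
  rank_child_at : forall x i, (1 <= i <= a)%N -> rank (child_at x i) = i }.

Lemma edge_subproof (G : graph) (x y : G) : adj x y ->
  `[< exists u v : G, adj u v /\ [fset x; y]%fset = [fset u; v]%fset >].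
Proof. by move=> xy; apply/asboolP; exists x, y. Qed.

Definition mk_edge (G : graph) (x y : G) (xy : adj x y) : edge G :=
  exist _ [fset x; y]%fset (edge_subproof xy).

Lemma edge_adj (G : graph) (x y : G) (f : edge G) :
  val f = [fset x; y]%fset -> adj x y.
Proof.
case: f => A /= /asboolP[u [v [uv ->]]] E.
have [xu yu] : x \in [fset u; v]%fset /\ y \in [fset u; v]%fset.
  by rewrite E !inE !eqxx orbT.
have [ux vx] : u \in [fset x; y]%fset /\ v \in [fset x; y]%fset.
  by rewrite -E !inE !eqxx orbT.
move: xu yu ux vx; rewrite !inE.
case/orP=> /eqP ->; case/orP=> /eqP -> //; rewrite ?orbb.
- by move=> _ /eqP vu; rewrite vu adj_irr in uv.
- by rewrite adj_sym.
- by move=> /eqP uv'; rewrite uv' adj_irr in uv.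
Qed.

(** Each edge is named by its child endpoint through [up], so configurations become predicates on
    vertices. Injectivity of [up] holds because levels forbid two vertices to be each other's
    parents. *)
Lemma ended_tree_genealogy (a : nat) (T : ended_tree a) (num : edge T -> nat) :
  is_numbering num ->
  exists (N : genealogy a (@level _ T)) (up : T -> edge T),
    [/\ injective up, forall x, num (up x) = rank N x &
      forall w (x y : open_graph w), adj x y =
        (y == parent N x) && w (up x) || (x == parent N y) && w (up y)].
Proof.
move=> numP; have [pi [adjE lev_pi]] := ended_tree_parent T.
have adj_pi x : adj x (pi x) by rewrite adjE eqxx.
pose up x := mk_edge (adj_pi x).
have childE x y : child x y <-> x = pi y.
  rewrite /child adjE; split=> [[/orP[/eqP ->|/eqP //]]|->].
    by rewrite lev_pi; lia.
  by rewrite eqxx orbT lev_pi; split => //; lia.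
have up_inj : injective up.
  move=> x y /(congr1 val) /= E.
  have : x \in [fset y; pi y]%fset by rewrite -E !inE eqxx.
  have : y \in [fset x; pi x]%fset by rewrite E !inE eqxx.
  rewrite !inE => /orP[/eqP ->//|/eqP yx] /orP[/eqP ->//|/eqP xy].
  by have := lev_pi x; have := lev_pi y; rewrite -yx -xy; lia.
have upE x y f : val f = [fset x; y]%fset -> x = pi y -> f = up y.
  by move=> fE xy; apply: val_inj; rewrite fE /= fsetUC xy.
have up_child y : child_edges (pi y) (up y).
  by exists y; [apply/childE|rewrite /= fsetUC].
have child_ex x i : (1 <= i <= a)%N -> exists y, pi y = x /\ num (up y) = i.
  move=> ia; have [_ _ surj] := numP x.
  have [f [y xy fE] <-] := surj i ia.
  by move/childE: xy => xy; exists y; rewrite -(upE _ _ _ fE).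
have num_bounds x : (1 <= num (up x) <= a)%N.
  by have [h _ _] := numP (pi x); apply: h (up_child x).
have num_inj x y : pi x = pi y -> num (up x) = num (up y) -> x = y.
  move=> pxy E; have [_ inj_num _] := numP (pi x).
  apply/up_inj/(inj_num (up x) (up y) _ _ E); rewrite inE.
    exact: up_child.
  by rewrite pxy; exact: up_child.
pose ch x i := if pselect (1 <= i <= a)%N is left ia
  then sval (cid (child_ex x i ia)) else x.
have chP x i : (1 <= i <= a)%N -> pi (ch x i) = x /\ num (up (ch x i)) = i.
  by move=> ia; rewrite /ch; case: pselect => // ia'; case: cid.
unshelve eexists; first refine
  (@Genealogy a T (@level _ T) pi (num \o up) ch lev_pi num_bounds _ _ _).
- move=> x /=; have [? ?] := chP (pi x) _ (num_bounds x).
  exact: num_inj.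
- by move=> x i ia; have [] := chP x i ia.
- by move=> x i ia; have [] := chP x i ia.
exists up; split => // w x y /=; apply/asboolP/orP => [[f [fE wf]]|].
  have := edge_adj fE; rewrite adjE => /orP[/eqP yx|/eqP xy].
    left; rewrite yx eqxx /= -(upE y x f) //; by rewrite fsetUC.
  by right; rewrite -(upE x y f) // {1}xy eqxx.
move=> [/andP[/eqP -> wx]|/andP[/eqP -> wy]].
  by exists (up x).
by exists (up y); split => //=; rewrite fsetUC.
Qed.

Lemma lev_iter_parent (a : nat) (V : choiceType) (lev : V -> int)
    (N : genealogy a lev) x n : lev (iter n (parent N) x) = lev x - n%:Z.
Proof. by elim: n => [|n IH] /=; rewrite ?subr0 // lev_parent IH; lia. Qed.

Section FirstLine.
Variables (a : nat) (V : choiceType) (lev : V -> int) (N : genealogy a lev).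
Hypothesis a1 : (1 <= a)%N.

(** In the percolation every edge numbered 1 is unmarked, so this line of descent is almost surely
    open. *)
Definition first_line (x : V) (n : nat) : V := iter n (child_at N ^~ 1%N) x.

Lemma parent_first_line x n : parent N (first_line x n.+1) = first_line x n.
Proof. by rewrite parent_child_at. Qed.

Lemma rank_first_line x n : rank N (first_line x n.+1) = 1%N.
Proof. by rewrite rank_child_at. Qed.

Lemma iter_parent_first_line x n : iter n (parent N) (first_line x n) = x.
Proof. by elim: n => // n IH; rewrite iterSr parent_first_line. Qed.

Lemma lev_first_line x n : lev (first_line x n) = lev x + n%:Z.
Proof.
elim: n => [|n IH]; first by rewrite addr0.
by have := lev_parent N (first_line x n.+1); rewrite parent_first_line; lia.
Qed.

End FirstLine.

Section Descendants.
Variables (a : nat) (V : choiceType) (lev : V -> int) (N : genealogy a lev).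
Variable k : nat.
Hypothesis ka : (k <= a)%N.

(** Generation [n] below [r] in the subtree that keeps the children of rank at most [k]. It is
    defined by ranks alone and compared with the open edges later; for [k = a] it lists all
    descendants of that generation. *)
Fixpoint desc (r : V) (n : nat) : seq V :=
  if n is m.+1 then [seq child_at N y i | y <- desc r m, i <- iota 1 k]
  else [:: r].

Lemma mem_desc r n z :
  (z \in desc r n.+1) = (parent N z \in desc r n) && (rank N z <= k)%N.
Proof.
apply/allpairsP/andP => /= [[[y i] /= [yr]]|[zr zk]].
  rewrite mem_iota => ik ->.
  have ia : (1 <= i <= a)%N by lia.
  by rewrite parent_child_at // rank_child_at //; split => //; lia.
exists (parent N z, rank N z); rewrite /= child_at_rank; split => //.
by rewrite mem_iota; have := rank_bounds N z; lia.
Qed.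

Lemma size_desc r n : size (desc r n) = (k ^ n)%N.
Proof. by elim: n => //= n IH; rewrite size_allpairs IH size_iota expnSr. Qed.

Lemma uniq_desc r n : uniq (desc r n).
Proof.
elim: n => //= n IH; apply: allpairs_uniq => //; first exact: iota_uniq.
move=> [y i] [z j] /= /allpairsP[[? ?] [_ /= + [-> ->]]].
move=> + /allpairsP[[? ?] [_ /= + [-> ->]]].
rewrite !mem_iota => ik jk E.
by congr (_, _); [move/(congr1 (parent N)): E|move/(congr1 (rank N)): E];
  rewrite ?parent_child_at ?rank_child_at //; lia.
Qed.

Lemma lev_desc r n z : z \in desc r n -> lev z = lev r + n%:Z.
Proof.
elim: n z => [|n IH] z; first by rewrite inE => /eqP ->; rewrite addr0.
by rewrite mem_desc => /andP[/IH]; rewrite lev_parent; lia.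
Qed.

Lemma iter_parent_desc r n j z :
  z \in desc r (n + j) -> iter j (parent N) z \in desc r n.
Proof.
elim: j z => [|j IH] z; first by rewrite addn0.
by rewrite addnS mem_desc => /andP[/IH]; rewrite -iterSr.
Qed.

Lemma iter_parent_root r n z : z \in desc r n -> iter n (parent N) z = r.
Proof. by rewrite -[n]add0n => /iter_parent_desc; rewrite inE add0n => /eqP. Qed.

Lemma first_line_desc r x n j : (1 <= k)%N ->
  x \in desc r n -> first_line N x j \in desc r (n + j).
Proof.
move=> k1 xr; have a1 := leq_trans k1 ka.
elim: j => [|j IH]; first by rewrite addn0.
by rewrite addnS mem_desc parent_first_line // IH rank_first_line.
Qed.

End Descendants.

(** * Tetrahedra in the horocyclic product *)

(** The tag [t x] reveals the block of [x], so distinct blocks are disjoint. *)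
Lemma uniq_flatten_tag (T I : eqType) (t : T -> I) (h : nat -> I)
    (F : nat -> seq T) (s : seq nat) : injective h -> uniq s ->
  (forall i, uniq (F i)) -> (forall i x, x \in F i -> t x = h i) ->
  uniq (flatten [seq F i | i <- s]).
Proof.
move=> inj_h + uF tF; elim: s => //= i s IH /andP[si us].
rewrite cat_uniq uF IH // andbT /=; apply/hasPn => x /flatten_mapP[j js xj].
apply/negP => xi; move: si; have : h i = h j by rewrite -(tF _ _ xi) (tF _ _ xj).
by move=> /inj_h ->; rewrite js.
Qed.

(* [o x] stands for the edge from [x] to its parent being open. *)
Section HorocyclicReach.
Variables (a' a : nat) (V' V : choiceType) (lev' : V' -> int) (lev : V -> int).
Variables (N' : genealogy a' lev') (N : genealogy a lev).
Variables (o' : pred V') (o : pred V).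

(** One coordinate moves to its parent and the other to a child: these are the moves that keep the
    levels opposite. *)
Definition hstep (u v : V' * V) : bool :=
  [&& v.1 == parent N' u.1, o' u.1, u.2 == parent N v.2 & o v.2] ||
  [&& u.1 == parent N' v.1, o' v.1, v.2 == parent N u.2 & o u.2].

Lemma hstep_sym : symmetric hstep.
Proof. by move=> u v; rewrite /hstep orbC. Qed.

Lemma reach_ancestor_line (x' : V') (x : V) n :
  (forall i, (i < n)%N -> o' (iter i (parent N') x')) ->
  (forall i, (i < n)%N -> o (first_line N x i.+1)) -> (1 <= a)%N ->
  reach hstep (x', x) (iter n (parent N') x', first_line N x n).
Proof.
move=> open' open a1; elim: n open' open => [|n IH] open' open.
  exact: reach_refl.
apply: reach_trans (IH _ _) _ => [i ni|i ni|].
- exact/open'/ltnW.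
- exact/open/ltnW.
apply: reach1; rewrite /hstep parent_first_line // !eqxx open' //=.
by rewrite open.
Qed.

Lemma reach_ancestor_line2 (x' : V') (x : V) n :
  (forall i, (i < n)%N -> o (iter i (parent N) x)) ->
  (forall i, (i < n)%N -> o' (first_line N' x' i.+1)) -> (1 <= a')%N ->
  reach hstep (x', x) (first_line N' x' n, iter n (parent N) x).
Proof.
move=> open open' a1; elim: n open' open => [|n IH] open' open.
  exact: reach_refl.
apply: reach_trans (IH _ _) _ => [i ni|i ni|].
- exact/open'/ltnW.
- exact/open/ltnW.
apply: reach1; rewrite /hstep parent_first_line // !eqxx open' //=.
by rewrite open // orbT.
Qed.

Section Tetrahedron.
Variables (k n : nat) (r' : V') (r : V).
(** Layer [i] pairs generation [n - i] below [r'] with generation [i] below [r], hence has [k ^ n]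
    elements. *)
Definition tetrahedron : seq (V' * V) :=
  flatten [seq [seq (x', x) | x' <- desc N' k r' (n - i), x <- desc N k r i]
          | i <- iota 0 n.+1].

Lemma mem_tetrahedron u : reflect
  (exists i, [/\ (i <= n)%N, u.1 \in desc N' k r' (n - i) & u.2 \in desc N k r i])
  (u \in tetrahedron).
Proof.
apply: (iffP flatten_mapP) => [[i + /allpairsP[[x' x] /= [x'r xr ->]]]|].
  by rewrite mem_iota => ni; exists i; split => //; lia.
move=> [i [ni x'r xr]]; exists i; first by rewrite mem_iota; lia.
by apply/allpairsP; exists u; split => //; case: u {x'r xr}.
Qed.

Lemma size_tetrahedron : size tetrahedron = (n.+1 * k ^ n)%N.
Proof.
rewrite size_flatten /shape -map_comp sumnE big_map.
rewrite (eq_big_seq (fun _ => k ^ n)%N) => [|i].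
  by rewrite big_const_seq count_predT size_iota iter_addn_0 mulnC.
rewrite mem_iota /= => ni; rewrite size_allpairs !size_desc -expnD.
by congr expn; lia.
Qed.

Lemma uniq_tetrahedron : (k <= a')%N -> (k <= a)%N -> uniq tetrahedron.
Proof.
move=> ka' ka; apply: (@uniq_flatten_tag _ _ (fun u => lev u.2)
  (fun i => lev r + i%:Z)).
- by move=> i j; lia.
- exact: iota_uniq.
- move=> i; apply: allpairs_uniq; try exact: uniq_desc.
  by move=> [? ?] [? ?].
- move=> i _ /allpairsP[[x' x] /= [_ xr ->]]; exact: (lev_desc ka xr).
Qed.

(** All conceivable exits, through open or closed edges: from layer 0, where the second coordinate
    is [r], and from layer [n], where the first one is [r']. *)
Definition tetrahedron_boundary : seq (V' * V) :=
  [seq (child_at N' x' i, parent N r) | x' <- desc N' k r' n, i <- iota 1 a'] ++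
  [seq (parent N' r', child_at N x i) | x <- desc N k r n, i <- iota 1 a].

Lemma size_tetrahedron_boundary :
  size tetrahedron_boundary = (k ^ n * (a' + a))%N.
Proof.
by rewrite size_cat !size_allpairs !size_desc !size_iota mulnDr.
Qed.

Hypotheses (k1 : (1 <= k)%N) (ka' : (k <= a')%N) (ka : (k <= a)%N).

(** The equality serves in both directions: edges of rank at most [k] are open, which gives
    connectedness, and the others are closed, which confines the neighbours. *)
Hypothesis exact' : forall x i, (i < n)%N -> parent N' x \in desc N' k r' i ->
  o' x = (rank N' x <= k)%N.
Hypothesis exact : forall x i, (i < n)%N -> parent N x \in desc N k r i ->
  o x = (rank N x <= k)%N.

(** A step changes the layer by one. The coordinate that moves to a child uses an open edge, hence
    one of rank at most [k], unless the step leaves through layer 0 or layer [n]. *)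
Lemma tetrahedron_hstep u v : u \in tetrahedron -> hstep u v ->
  (v \in tetrahedron) || (v \in tetrahedron_boundary).
Proof.
case: u v => x' x [y' y] /mem_tetrahedron[i /= [ni x'r xr]].
rewrite /hstep /= => /orP[/and4P[/eqP -> ox' /eqP xE oy]|
                         /and4P[/eqP x'E oy' /eqP -> ox]].
- have [ltin|lein] := ltnP i n.
    apply/orP; left; apply/mem_tetrahedron; exists i.+1; split => //=.
      move: x'r; have -> : (n - i = (n - i.+1).+1)%N by lia.
      by rewrite mem_desc // => /andP[].
    by rewrite mem_desc // -xE xr -(exact ltin) // -xE.
  have ? : i = n by lia.
  subst i; apply/orP; right; rewrite mem_cat; apply/orP; right.
  move: x'r; rewrite subnn inE => /eqP ->.
  apply/allpairsP; exists (x, rank N y); split => //=.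
    by rewrite mem_iota; have := rank_bounds N y; lia.
  by rewrite xE child_at_rank.
- case: i ni x'r xr => [|i] ni x'r xr.
    apply/orP; right; rewrite mem_cat; apply/orP; left.
    move: xr; rewrite inE => /eqP ->; rewrite subn0 in x'r.
    apply/allpairsP; exists (x', rank N' y'); split => //=.
      by rewrite mem_iota; have := rank_bounds N' y'; lia.
    by rewrite x'E child_at_rank.
  apply/orP; left; apply/mem_tetrahedron; exists i; split => //=; first exact: ltnW.
    have E : (n - i = (n - i.+1).+1)%N by lia.
    rewrite E mem_desc // -x'E x'r -(exact' (i := n - i.+1)) //; last by rewrite -x'E.
    by lia.
  by move: xr; rewrite mem_desc // => /andP[].
Qed.

(** While the first coordinate climbs from the leaf [z'] to [r'], the second one descends from [r]
    to the leaf [z], crossing the layers one by one. *)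
Lemma tetrahedron_segment z' z i : z' \in desc N' k r' n -> z \in desc N k r n ->
  (i <= n)%N ->
  reach hstep (z', r) (iter i (parent N') z', iter (n - i) (parent N) z).
Proof.
move=> z'r zr; elim: i => [|i IH] ni.
  by rewrite subn0 (iter_parent_root ka zr); exact: reach_refl.
apply: reach_trans (IH (ltnW ni)) _; apply: reach1.
have z'E : (n = (n - i) + i)%N by lia.
have zE : (n = i.+1 + (n - i.+1))%N by lia.
have Ei : (n - i = (n - i.+1).+1)%N by lia.
apply/orP; left; rewrite Ei /= !eqxx /=.
have : iter i (parent N') z' \in desc N' k r' (n - i).
  by apply: iter_parent_desc => //; rewrite -z'E.
have : iter (n - i.+1) (parent N) z \in desc N k r i.+1.
  by apply: iter_parent_desc => //; rewrite -zE.
rewrite Ei !mem_desc // => /andP[pz rz] /andP[pz' rz'].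
rewrite (exact' (i := n - i.+1)) ?(exact (i := i)) ?rz ?rz' //; lia.
Qed.

(** Extending both coordinates by first children puts each pair on a segment from [(z', r)] to
    [(r', z)] with leaves [z'], [z]. The segments of [(z', z)] and [(t', t)] are linked by that of
    [(t', z)]. *)
Lemma tetrahedron_reach u v : u \in tetrahedron -> v \in tetrahedron ->
  reach hstep u v.
Proof.
have leaf w : w \in tetrahedron -> exists z' z i,
   [/\ z' \in desc N' k r' n, z \in desc N k r n, (i <= n)%N &
    w = (iter i (parent N') z', iter (n - i) (parent N) z)].
  case: w => x' x /mem_tetrahedron[i /= [ni x'r xr]].
  exists (first_line N' x' i), (first_line N x (n - i)), i; split => //.
  - by have := first_line_desc ka' i k1 x'r; rewrite subnK.
  - by have := first_line_desc ka (n - i) k1 xr; rewrite subnKC.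
  - by rewrite !iter_parent_first_line // (leq_trans k1).
move=> /leaf[z' [z [i [z'r zr ni ->]]]] /leaf[t' [t [j [t'r tr nj ->]]]].
have sym := reach_sym hstep_sym.
apply: reach_trans (sym _ _ (tetrahedron_segment z'r zr ni)) _.
apply: reach_trans (tetrahedron_segment z'r zr (leqnn n)) _.
(* Both ancestors are [r'], so the segments of [(z', z)] and [(t', z)] share the end [(r', z)]. *)
have -> : iter n (parent N') z' = iter n (parent N') t'.
  by rewrite !(iter_parent_root ka' (r := r')).
rewrite subnn /=; apply: reach_trans (tetrahedron_segment t'r tr nj).
have := tetrahedron_segment t'r zr (leqnn n); rewrite subnn /=.
exact: sym.
Qed.

End Tetrahedron.

(* If the ancestor lines of both coordinates are cut, then the two coordinates
   stay below the cuts, and the relation between levels bounds both depths. *)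
Lemma cut_reach (x' : V') (x : V) (m' m : nat) u :
  lev' x' = - lev x ->
  ~~ o' (iter m' (parent N') x') -> ~~ o (iter m (parent N) x) ->
  reach hstep (x', x) u ->
  u \in [seq (y', y) |
    y' <- flatten [seq desc N' a' (iter m' (parent N') x') i
                  | i <- iota 0 (m' + m).+1],
    y <- flatten [seq desc N a (iter m (parent N) x) i
                 | i <- iota 0 (m' + m).+1]].
Proof.
move=> lev_xx cut' cut [p [xp <-]].
set t' := iter m' _ x'; set t := iter m _ x.
pose inv (v : V' * V) := [/\ lev' v.1 = - lev v.2,
  exists i, v.1 \in desc N' a' t' i & exists i, v.2 \in desc N a t i].
have in_desc' (y : V') n : y \in desc N' a' (iter n (parent N') y) n.
  elim: n y => [|n IH] y; first by rewrite inE.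
  by rewrite mem_desc // iterSr IH; have /andP[] := rank_bounds N' y.
have in_desc (y : V) n : y \in desc N a (iter n (parent N) y) n.
  elim: n y => [|n IH] y; first by rewrite inE.
  by rewrite mem_desc // iterSr IH; have /andP[] := rank_bounds N y.
have inv_step v w : inv v -> hstep v w -> inv w.
  case: v w => v' v [w' w] [/= lev_v [i v'i] [j vj]].
  move=> /orP[] /= /and4P[/eqP h1 h2 /eqP h3 h4].
    split => /=; first by have := lev_parent N w; rewrite h1 -h3 lev_parent lev_v; lia.
      case: i v'i => [|i] v'i.
        by move: v'i h2; rewrite inE => /eqP ->; rewrite (negbTE cut').
      by exists i; move: v'i; rewrite mem_desc // h1 => /andP[].
    by exists j.+1; rewrite mem_desc // -h3 vj; have /andP[] := rank_bounds N w.
  split => /=; first by have := lev_parent N' w'; rewrite h3 -h1 lev_parent lev_v; lia.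
    by exists i.+1; rewrite mem_desc // -h1 v'i; have /andP[] := rank_bounds N' w'.
  case: j vj => [|j] vj.
    by move: vj h4; rewrite inE => /eqP ->; rewrite (negbTE cut).
  by exists j; move: vj; rewrite mem_desc // h3 => /andP[].
have inv_x : inv (x', x).
  by split => //=; [exists m'; exact: in_desc'|exists m; exact: in_desc].
have {inv_x}[lev_l [i lastE'] [j lastE]] : inv (last (x', x) p).
  elim: p (x', x) inv_x xp => //= w p IH v inv_v /andP[vw wp].
  exact: IH (inv_step _ _ inv_v vw) wp.
have Ej := lev_desc (leqnn _) lastE; have Ei := lev_desc (leqnn _) lastE'.
have := lev_iter_parent N x m; have := lev_iter_parent N' x' m'.
rewrite -/t -/t' => tE' tE.
(* Opposite levels give [i + j = m' + m], so both depths stay within the listed range. *)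
apply/allpairsP; exists (last (x', x) p); split; last by case: (last _ _).
  by apply/flatten_mapP; exists i => //; rewrite mem_iota; lia.
by apply/flatten_mapP; exists j => //; rewrite mem_iota; lia.
Qed.

End HorocyclicReach.

(** * Deterministic amenability of the percolated Diestel-Leader graph *)

Lemma counting_seq (R : realType) (T : choiceType) (t : seq T) : uniq t ->
  counting [set` t] = (size t)%:R%:E :> \bar R.
Proof.
move=> ut; have fin_t : finite_set [set` t] by apply/finite_seqP; exists t.
rewrite /counting asboolT //; congr (_%:R%:E); apply/perm_size.
apply: uniq_perm => // x.
apply/idP/idP; rewrite in_fset_set //.
  by move=> /set_mem.
by move=> xt; apply/mem_set.
Qed.

Lemma counting_le_size (R : realType) (T U : choiceType) (f : T -> U)
    (A : set T) (b : seq U) : injective f -> (forall x, A x -> f x \in b) ->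
  (counting A <= (size b)%:R%:E :> \bar R)%E.
Proof.
move=> inj_f Ab; have fin_A : finite_set A.
  apply: (@sub_finite_set _ _ (f @^-1` [set` b])) => //.
  apply: finite_preimage; first by move=> x y _ _; exact: inj_f.
  by apply/finite_seqP; exists b.
rewrite /counting asboolT // lee_fin ler_nat -(size_map f).
apply: uniq_leq_size => [|_ /mapP[x + ->]].
  by rewrite map_inj_uniq //; exact: fset_uniq.
by rewrite in_fset_set // => /set_mem; exact: Ab.
Qed.

(** Viewed in the induced subgraph, [s] has all its outer neighbours in [b], so its boundary ratio
    is at most [1/n] for positive [n]. *)
Lemma amenable_of_folner (R : realType) (H : graph) (o : H) :
  (forall n : nat, exists s b : seq H,
    [/\ uniq s, s != [::], forall x, x \in s -> component o x,
        forall x y, x \in s -> adj x y -> (y \in s) || (y \in b) &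
        (n * size b <= size s)%N]) ->
  amenable (induced_subgraph (component o)) R.
Proof.
move=> folner; apply/eqP; rewrite eq_le; apply/andP; split; last first.
  apply: le_ereal_inf_tmp => _ [C [_ _] <-].
  by rewrite mule_ge0 // ?inve_ge0 /counting; case: ifP.
apply/lee_addgt0Pr => e e0; rewrite add0e.
(* This [n] exceeds [1/e], which makes the boundary ratio at most [e]. *)
set n := (Num.truncn e^-1).+1.
have [s [b [us s0 sC sb leq_sb]]] := folner n.
pose K := induced_subgraph (component o).
pose t : seq K := pmap insub s.
have val_t : map val t = s.
  rewrite pmap_filter; last exact: insubK.
  by apply/all_filterP/allP => x xs; rewrite isSome_insub inE; exact: sC.
have mem_t (x : K) : (x \in t) = (val x \in s).
  by rewrite -val_t mem_map //; exact: val_inj.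
have ut : uniq t by rewrite pmap_sub_uniq.
have st : size t = size s by rewrite -val_t size_map.
have s_gt0 : (0 < size s)%N by rewrite lt0n size_eq0.
apply: ge_ereal_inf; exists (counting (boundary [set` t]) / counting [set` t])%E.
  exists [set` t] => //; split; first by apply/finite_seqP; exists t.
  case: t st s_gt0 {mem_t ut val_t} => [<- //|x t] _ _.
  by exists x; rewrite /= inE eqxx.
rewrite counting_seq // st.
rewrite inver pnatr_eq0 eqn0Ngt s_gt0 /=.
have : (counting (boundary [set` t]) <= (size b)%:R%:E :> \bar R)%E.
  apply: (@counting_le_size R K H val); first exact: val_inj.
  move=> y [/= yt [x xt xy]]; move: yt xt; rewrite /= !mem_t => /negP ys xs.
  by have := sb _ _ xs xy; rewrite (negbTE ys).
move=> /(lee_wpmul2r (x := ((size s)%:R^-1)%:E))/le_trans; apply.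
  by rewrite lee_fin invr_ge0.
rewrite -EFinM lee_fin ler_pdivrMr ?ltr0n //.
have ne : 1 <= n%:R * e.
  by rewrite -ler_pdivrMr // div1r ltW // truncnS_gt.
apply: le_trans (_ : n%:R * e * (size b)%:R <= _).
  by rewrite -[leLHS]mul1r; apply: ler_wpM2r.
rewrite mulrAC mulrC; apply: ler_wpM2l; first exact: ltW.
by rewrite -natrM ler_nat.
Qed.

Section DLOpen.
Variables (a' a : nat) (T' : ended_tree a') (T : ended_tree a).
Variables (N' : genealogy a' (@level _ T')) (N : genealogy a (@level _ T)).
Variables (up' : T' -> edge T') (up : T -> edge T).
Variables (w' : edge T' -> bool) (w : edge T -> bool).
Hypothesis open_adj' : forall x y : open_graph w', adj x y =
  (y == parent N' x) && w' (up' x) || (x == parent N' y) && w' (up' y).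
Hypothesis open_adj : forall x y : open_graph w, adj x y =
  (y == parent N x) && w (up x) || (x == parent N y) && w (up y).

Let H := DL_open w' w.
Let step := hstep N' N (w' \o up') (w \o up).

(** If both coordinates moved towards their ends, or both away, the levels could not be opposite at
    both vertices. *)
Lemma DL_open_adj (u v : H) : adj u v = step (val u) (val v).
Proof.
case: u v => [[x' x] /= /eqP xx] [[y' y] /= /eqP yy].
rewrite -[LHS]/(@adj (open_graph w') x' y' && @adj (open_graph w) x y).
rewrite open_adj' open_adj /step /hstep /=.
have [yx'|_] := eqVneq y' (parent N' x');
  have [xy'|_] := eqVneq x' (parent N' y');
  have [yx|_] := eqVneq y (parent N x); have [xy|_] := eqVneq x (parent N y);
  rewrite /= ?andbF ?andbT ?orbF //.
all: have := lev_parent N' x'; have := lev_parent N' y'.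
all: have := lev_parent N x; have := lev_parent N y.
all: by rewrite -?yx' -?xy' -?yx -?xy; lia.
Qed.

Lemma hstep_level (u v : T' * T) :
  step u v -> level u.1 == - level u.2 -> level v.1 == - level v.2.
Proof.
move=> /orP[]/and4P[/eqP E' _ /eqP E _] /eqP uu; apply/eqP.
  by have := lev_parent N' u.1; have := lev_parent N v.2; rewrite -E' -E; lia.
by have := lev_parent N' v.1; have := lev_parent N u.2; rewrite -E' -E; lia.
Qed.

(** Steps preserve the level relation, so a walk in the plain product of the vertex sets lifts to
    the graph [H]. *)
Lemma DL_component (u v : H) : component u v <-> reach step (val u) (val v).
Proof.
split=> [[p [up_ <-]]|[p [+ +]]].
  elim: p u up_ => [|z p IH] u /=; first by move=> _; exact: reach_refl.
  move=> /andP[uz /IH]; apply: reach_trans; apply: reach1.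
  by rewrite -DL_open_adj.
elim: p u => [|z p IH] u /=.
  by move=> _ /val_inj <-; exact: (@reach_refl H (@adj H)).
move=> /andP[uz zp] lastE.
pose z1 : H := exist _ z (hstep_level uz (valP u)).
apply: (@reach_trans H (@adj H) z1); last exact: IH.
by apply: reach1; rewrite DL_open_adj.
Qed.

Let root : H := DL_root T' T.

(** The component is finite; taken as a whole it has empty boundary. *)
Lemma DL_amenable_cut (R : realType) m' m :
  ~~ w' (up' (iter m' (parent N') (tree_root T'))) ->
  ~~ w (up (iter m (parent N) (tree_root T))) ->
  amenable (induced_subgraph (component root)) R.
Proof.
move=> cut' cut; apply: amenable_of_folner => n.
have [L inL] : exists L : seq (T' * T), forall u, reach step (val root) u -> u \in L.
  have lev0 := eqP (DL_root_subproof T' T).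
  eexists => u; exact: (@cut_reach _ _ _ _ _ _ N' N (w' \o up') (w \o up)
    _ _ m' m u lev0 cut' cut).
pose s : seq H := [seq v <- pmap insub (undup L) | `[< component root v >]].
have mem_s v : component root v -> v \in s.
  move=> rv; rewrite mem_filter asboolT //= mem_pmap_sub /= mem_undup.
  by apply: inL; exact/DL_component.
exists s, [::]; split; rewrite ?muln0 //.
- by rewrite filter_uniq // pmap_sub_uniq // undup_uniq.
- suff : root \in s by case: (s).
  apply: mem_s; exact: (@reach_refl H (@adj H)).
- by move=> x; rewrite mem_filter => /andP[/asboolP].
- move=> x y; rewrite mem_filter => /andP[/asboolP rx _] xy; rewrite mem_s //.
  by apply: (@reach_trans H (@adj H) x) => //; exact: reach1.
Qed.

Lemma DL_amenable_tetrahedra (R : realType) (k : nat) :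
  (1 <= k)%N -> (k <= a')%N -> (k <= a)%N ->
  (forall n, (0 < n)%N -> exists r' r,
    [/\ forall x i, (i < n)%N -> parent N' x \in desc N' k r' i ->
          w' (up' x) = (rank N' x <= k)%N,
        forall x i, (i < n)%N -> parent N x \in desc N k r i ->
          w (up x) = (rank N x <= k)%N &
        exists2 u, u \in tetrahedron N' N k n r' r & reach step (val root) u]) ->
  amenable (induced_subgraph (component root)) R.
Proof.
move=> k1 ka' ka tetra; apply: amenable_of_folner => m.
(* The height exceeds [m * (a' + a)], so that [n.+1 * k ^ n] is at least [m] times the boundary
   bound [k ^ n * (a' + a)]. *)
have [r' [r [exact' exact_ [u us ru]]]] := tetra (m * (a' + a)).+1 isT.
set n := (m * (a' + a)).+1 in exact' exact_ us.
pose lift (l : seq (T' * T)) : seq H := pmap insub l.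
have size_lift l : (size (lift l) <= size l)%N.
  by rewrite size_pmap_sub count_size.
have mem_lift l (v : H) : (v \in lift l) = (val v \in l) by rewrite mem_pmap_sub.
have reach_s v : v \in tetrahedron N' N k n r' r -> reach step (val root) v.
  move=> vs; apply: reach_trans ru _.
  exact: (tetrahedron_reach k1 ka' ka exact' exact_ us vs).
have level_reach v : reach step (val root) v -> level v.1 == - level v.2.
  move=> [p [+ <-]]; elim: p (val root) (valP root) => //= z p IH y yy /andP[yz].
  exact/IH/(hstep_level yz yy).
exists (lift (tetrahedron N' N k n r' r)), (lift (tetrahedron_boundary N' N k n r' r)).
(* No pair is lost: all of them are reached from the root and so satisfy the level relation. *)
have size_s : size (lift (tetrahedron N' N k n r' r)) = (n.+1 * k ^ n)%N.
  rewrite size_pmap_sub -(size_tetrahedron N' N k n r' r).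
  by apply/eqP; rewrite -all_count; apply/allP => v /reach_s /level_reach.
split.
- by apply: pmap_sub_uniq; exact: uniq_tetrahedron.
- by rewrite -size_eq0 size_s muln_eq0 expn_eq0 negb_or /= eqn0Ngt k1.
- by move=> x; rewrite mem_lift => /reach_s /DL_component.
- move=> x y; rewrite !mem_lift DL_open_adj.
  exact: (tetrahedron_hstep k1 ka' ka exact' exact_).
- rewrite size_s (leq_trans (leq_mul (leqnn m) (size_lift _))) //.
  rewrite size_tetrahedron_boundary mulnCA mulnC leq_mul2r; apply/orP; right.
  by rewrite /n; lia.
Qed.

(* The tetrahedra are reached by walking up the ancestors of one root while
   walking down the first children, which are open, of the other root. *)
Lemma DL_amenable (R : realType) (k : nat) :
  (1 <= k)%N -> (k <= a')%N -> (k <= a)%N ->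
  (forall n, w' (up' (first_line N' (tree_root T') n.+1))) ->
  (forall n, w (up (first_line N (tree_root T) n.+1))) ->
  (forall n, (0 < n)%N -> exists j,
     (forall x i, (i < n)%N ->
        parent N' x \in desc N' k (iter (j + n) (parent N') (tree_root T')) i ->
        w' (up' x) = (rank N' x <= k)%N) /\
     (forall x i, (i < n)%N ->
        parent N x \in desc N k (first_line N (tree_root T) j) i ->
        w (up x) = (rank N x <= k)%N)) ->
  (forall n, (0 < n)%N -> exists j,
     (forall x i, (i < n)%N ->
        parent N' x \in desc N' k (first_line N' (tree_root T') j) i ->
        w' (up' x) = (rank N' x <= k)%N) /\
     (forall x i, (i < n)%N ->
        parent N x \in desc N k (iter (j + n) (parent N) (tree_root T)) i ->
        w (up x) = (rank N x <= k)%N)) ->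
  amenable (induced_subgraph (component root)) R.
Proof.
move=> k1 ka' ka line' line up_down down_up.
have a'1 := leq_trans k1 ka'; have a1 := leq_trans k1 ka.
have first_add (T0 : choiceType) b (l : T0 -> int) (M : genealogy b l) x j n :
    first_line M x (j + n) = first_line M (first_line M x j) n.
  by rewrite /first_line addnC iterD.
have [anc'|] := pselect (forall i, w' (up' (iter i (parent N') (tree_root T')))).
  apply: (DL_amenable_tetrahedra R k1 ka' ka) => n n0.
  have [j [exact' exact_]] := up_down n n0.
  exists (iter (j + n) (parent N') (tree_root T')).
  exists (first_line N (tree_root T) j); split => //.
  exists (iter (j + n) (parent N') (tree_root T'),
          first_line N (tree_root T) (j + n)).
    (* The tetrahedron is entered in layer [n]: its first coordinate is [r'], and the first line has
       gone [n] generations below [r]. *)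
    apply/mem_tetrahedron => //; exists n; rewrite leqnn subnn inE eqxx; split => //.
    by rewrite first_add -{3}[n]add0n; apply: first_line_desc => //; rewrite inE.
  by apply: reach_ancestor_line => // i _ /=; [exact: anc'|exact: line].
move=> /existsNP[m' /negP cut'].
have [anc|] := pselect (forall i, w (up (iter i (parent N) (tree_root T)))).
  apply: (DL_amenable_tetrahedra R k1 ka' ka) => n n0.
  have [j [exact' exact_]] := down_up n n0.
  exists (first_line N' (tree_root T') j).
  exists (iter (j + n) (parent N) (tree_root T)); split => //.
  exists (first_line N' (tree_root T') (j + n),
          iter (j + n) (parent N) (tree_root T)).
    (* With the roles of the trees exchanged, the entry is in layer 0. *)
    apply/mem_tetrahedron => //; exists 0%N; rewrite subn0 inE eqxx; split => //.
    by rewrite first_add -{3}[n]add0n; apply: first_line_desc => //; rewrite inE.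
  by apply: reach_ancestor_line2 => // i _ /=; [exact: anc|exact: line'].
by move=> /existsNP[m /negP cut]; exact: DL_amenable_cut cut' cut.
Qed.

End DLOpen.

(** * Independent cylinders *)

(** By independence, the first [N] events all fail with probability at most [(1 - c) ^+ N], which
    tends to 0. *)
Lemma independent_compl_null (R : realType) d (X : measurableType d)
    (P : probability X R) (E : nat -> set X) (c : R) :
  (forall j, measurable (E j)) ->
  (forall K : {fset nat}, P (\bigcap_(j in [set` K]) E j)
     = (\prod_(j <- K) P (E j))%E) ->
  0 < c -> (forall j, (c%:E <= P (E j))%E) ->
  P (\bigcap_j ~` E j) = 0%E.
Proof.
move=> mE indep c0 cE; pose q j := fine (P (E j)).
have PE j : P (E j) = (q j)%:E by rewrite fineK // fin_num_measure.
have q1 j : q j <= 1 by rewrite -lee_fin -PE probability_le1.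
have cq j : c <= q j by rewrite -lee_fin -PE.
(* Independence passes to complements one event at a time: [D N.+1 K] is [D N K] minus [D N] of [K]
   enlarged by [N]. The product formula for all [K] beyond [N] makes the induction go through. *)
pose D N (K : {fset nat}) :=
  \bigcap_(i in `I_N) ~` E i `&` \bigcap_(j in [set` K]) E j.
have mD N K : measurable (D N K).
  by apply: measurableI; apply: bigcap_measurableType => j _ //; exact: measurableC.
have PD N : forall K : {fset nat}, (forall j, j \in K -> (N <= j)%N) ->
    P (D N K) = (\prod_(i < N) (1 - q i) * \prod_(j <- K) q j)%:E.
  elim: N => [|N IH] K NK.
    rewrite big_ord0 mul1r /D II0 bigcap_set0 setTI indep -prodEFin.
    by apply: eq_bigr => j _.
  have NNK : N \notin K by apply/negP => /NK; rewrite ltnn.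
  have -> : D N.+1 K = D N K `\` E N.
    apply/seteqP; split => x.
      move=> [ne e]; split; last exact: (ne N (ltnSn N)).
      by split => // i /= iN; apply: ne => /=; exact: ltnW.
    move=> [[ne e] neN]; split => // i /=; rewrite ltnS leq_eqVlt.
    by move=> /orP[/eqP -> //|]; exact: ne.
  have DU : D N (N |` K)%fset = D N K `&` E N.
    apply/seteqP; split => x.
      move=> [ne e]; split; last by apply: e; rewrite /= !inE eqxx.
      by split => // j /= jK; apply: e; rewrite /= !inE jK orbT.
    move=> [[ne e] eN]; split => // j /=; rewrite !inE => /orP[/eqP -> //|].
    exact: e.
  have : P (D N K) = (P (D N K `\` E N) + P (D N (N |` K)%fset))%E.
    by rewrite DU; apply: measureDI => //; exact: mD.
  rewrite !IH; last 2 first.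
  - by move=> j; rewrite !inE => /orP[/eqP -> //|/NK /ltnW].
  - by move=> j /NK /ltnW.
  rewrite big_fsetU1 //= big_ord_recr /=.
  rewrite -[P (D N K `\` E N)]fineK; last first.
    by rewrite fin_num_measure //; exact: measurableD.
  by rewrite -EFinD => -[H]; congr EFin; lra.
have bound N : (P (\bigcap_j ~` E j) <= ((1 - c) ^+ N)%:E)%E.
  apply: (@le_trans _ _ (P (D N fset0))).
    apply: le_measure; rewrite ?inE //.
      by apply: bigcap_measurableType => j _; exact: measurableC.
    by move=> x ne; split => [i _|j /=]; [exact: ne|rewrite inE].
  rewrite PD // big_seq_fset0 mulr1 lee_fin.
  rewrite -[X in _ ^+ X]card_ord -prodr_const; apply: ler_prod => i _.
  by rewrite subr_ge0 q1 /= lerD2l lerN2.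
have fin : P (\bigcap_j ~` E j) \is a fin_num.
  by rewrite fin_num_measure //; apply: bigcap_measurableType => j _; exact: measurableC.
apply/eqP; rewrite eq_le measure_ge0 andbT -[leLHS]fineK // lee_fin.
have lt1 : `|1 - c| < 1.
  by rewrite ger0_norm; have := cq 0%N; have := q1 0%N; lra.
apply: (cvgr_to_ge (cvg_expr lt1)); apply: nearW => n.
by rewrite -lee_fin fineK.
Qed.


(** * Cylinders under a product measure *)

Section ProductMeasure.
Variables (R : realType) (I : choiceType).

Definition cylinder (F : {fset I}) (A : I -> set bool) : set (config I) :=
  [set w | forall i, i \in F -> A i (w i)].

Lemma measurable_cylinder (F : {fset I}) (A : I -> set bool) :
  measurable (cylinder F A).
Proof.
have mcoord i (B : set bool) : measurable [set w : config I | B (w i)].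
  have mi : measurable [set w : config I | w i].
    by apply: sub_sigma_algebra; exists i.
  have mcst (Q : Prop) : measurable [set _ : config I | Q].
    have [q|nq] := pselect Q.
      by rewrite (_ : [set _ | _] = setT) //; apply/seteqP; split.
    by rewrite (_ : [set _ | _] = set0) //; apply/seteqP; split.
  rewrite [X in measurable X](_ : _ =
      ([set _ | B true] `&` [set w | w i]) `|`
      ([set _ | B false] `&` ~` [set w | w i]) :> set (config I)).
    apply: measurableU; apply: measurableI; [exact: mcst|exact: mi|exact: mcst|].
    exact: measurableC.
  apply/seteqP; split => w /=; case: (w i); [by left|by right| |];
    by case=> -[].
have -> : cylinder F A = \bigcap_(i in [set` F]) [set w | A i (w i)] by [].
by apply: fin_bigcap_measurable => // i _; exact: mcoord.
Qed.

Variables (nu : I -> probability bool R) (mu : probability (config I) R).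
Hypothesis muP : is_product_measure nu mu.

(** As all cylinders use the same family [A], their intersection is the cylinder over the union of
    the [F j], and the product splits along this disjoint union. *)
Lemma product_measure_cylinders (F : nat -> {fset I}) (A : I -> set bool) :
  (forall i j, i != j -> [disjoint F i & F j]%fset) ->
  forall K : {fset nat}, mu (\bigcap_(j in [set` K]) cylinder (F j) A)
    = (\prod_(j <- K) mu (cylinder (F j) A))%E.
Proof.
move=> disjF K.
have -> : \bigcap_(j in [set` K]) cylinder (F j) A
    = cylinder (\bigcup_(j <- K) F j)%fset A.
  apply/seteqP; split => w wF.
    move=> i /bigfcupP[j]; rewrite andbT => jK ij; exact: (wF j jK).
  by move=> j jK i ij; apply: wF; apply/bigfcupP; exists j => //; rewrite andbT.
rewrite [LHS]muP partition_disjoint_bigfcup; last by move=> i j _ _; exact: disjF.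
by apply: eq_bigr => j _; rewrite -muP.
Qed.

Lemma product_measure_cylinder_ge (F : {fset I}) (A : I -> set bool) (q : R) n :
  0 <= q <= 1 -> (forall i, i \in F -> (q%:E <= nu i (A i))%E) ->
  (#|` F| <= n)%N -> ((q ^+ n)%:E <= mu (cylinder F A))%E.
Proof.
move=> /andP[q0 q1] qA Fn; rewrite [leRHS]muP.
apply: (@le_trans _ _ (q ^+ size F)%:E).
  by rewrite lee_fin; apply: ler_wiXn2l.
have {}qA : forall i, i \in enum_fset F -> (q%:E <= nu i (A i))%E by exact: qA.
elim: (enum_fset F) qA => [|i s IH] {}qA; first by rewrite big_nil.
rewrite big_cons /= exprS EFinM; apply: lee_pmul.
- by rewrite lee_fin.
- by rewrite lee_fin exprn_ge0.
- by apply: qA; rewrite inE eqxx.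
- by apply: IH => j js; apply: qA; rewrite inE js orbT.
Qed.

End ProductMeasure.

(** The rectangles formed by the two [j]-th cylinders are independent and have probability at least
    [c' * c]. *)
Lemma ae_exists_cylinder (R : realType) (I' I : choiceType)
    (nu' : I' -> probability bool R) (nu : I -> probability bool R)
    (mu' : probability (config I') R) (mu : probability (config I) R)
    (F' : nat -> {fset I'}) (F : nat -> {fset I})
    (A' : I' -> set bool) (A : I -> set bool) (c' c : R) :
  is_product_measure nu' mu' -> is_product_measure nu mu ->
  (forall i j, i != j -> [disjoint F' i & F' j]%fset) ->
  (forall i j, i != j -> [disjoint F i & F j]%fset) ->
  0 < c' -> 0 < c -> (forall j, (c'%:E <= mu' (cylinder (F' j) A'))%E) ->
  (forall j, (c%:E <= mu (cylinder (F j) A))%E) ->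
  {ae (mu' \x mu)%E, forall w : config I' * config I,
    exists j, cylinder (F' j) A' w.1 /\ cylinder (F j) A w.2}.
Proof.
move=> mu'P muP disjF' disjF c'0 c0 c'F cF.
pose E j := cylinder (F' j) A' `*` cylinder (F j) A.
have mE j : measurable (E j).
  by apply: measurableX; exact: measurable_cylinder.
exists (\bigcap_j ~` E j); split.
- by apply: bigcap_measurableType => j _; exact: measurableC.
- apply: (@independent_compl_null _ _ _ (mu' \x mu)%E E (c' * c)) => //.
  + move=> K; have -> : \bigcap_(j in [set` K]) E j =
        (\bigcap_(j in [set` K]) cylinder (F' j) A') `*`
        (\bigcap_(j in [set` K]) cylinder (F j) A).
      apply/seteqP; split => w wE.
        by split=> j jK; have [] := wE j jK.
      by case: wE => w1 w2 j jK; split; [exact: w1|exact: w2].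
    transitivity (mu' (\bigcap_(j in [set` K]) cylinder (F' j) A') *
        mu (\bigcap_(j in [set` K]) cylinder (F j) A))%E.
      by apply: product_measure1E; apply: bigcap_measurableType => j _;
        exact: measurable_cylinder.
    rewrite (product_measure_cylinders mu'P A' disjF').
    rewrite (product_measure_cylinders muP A disjF) -big_split /=.
    apply: eq_bigr => j _; apply/esym.
    by apply: product_measure1E; exact: measurable_cylinder.
  + exact: mulr_gt0.
  + move=> j; rewrite [leRHS]product_measure1E; try exact: measurable_cylinder.
    rewrite EFinM; apply: lee_pmul; [| |exact: c'F|exact: cF].
      by rewrite lee_fin ltW.
    by rewrite lee_fin ltW.
- move=> w /= nE j _ Ej; apply: nE; by exists j.
Qed.

(** * Exactly k-ary patterns *)

Lemma bernoulli_prob_set1 (R : realType) (p : R) (b : bool) : 0 <= p <= 1 ->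
  bernoulli_prob p [set b] = (if b then p else 1 - p)%:E.
Proof. by move=> p01; rewrite /bernoulli_prob p01 fsbig_set1. Qed.

Lemma bernoulli_prob1_false (R : realType) :
  bernoulli_prob 1 [set false] = 0%E :> \bar R.
Proof. by rewrite bernoulli_prob_set1 ?subrr //; lra. Qed.

Lemma ae_product_snd (R : realType) (I' I : choiceType)
    (nu : I -> probability bool R) (mu' : probability (config I') R)
    (mu : probability (config I) R) (i : I) :
  is_product_measure nu mu -> nu i [set false] = 0%E ->
  {ae (mu' \x mu)%E, forall w : config I' * config I, w.2 i}.
Proof.
move=> muP nu0; set F := cylinder [fset i]%fset (fun=> [set false]).
have muF : mu F = 0%E by rewrite [LHS]muP big_seq_fset1.
exists (setT `*` F); split.
  by apply: measurableX => //; exact: measurable_cylinder.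
  rewrite [LHS]product_measure1E //; last exact: measurable_cylinder.
  by apply/eqP; rewrite mule_eq0; apply/orP; right; apply/eqP.
move=> w /= wi; split => // j; rewrite inE => /eqP ->.
exact/negbTE/negP.
Qed.

Lemma ae_product_fst (R : realType) (I' I : choiceType)
    (nu' : I' -> probability bool R) (mu' : probability (config I') R)
    (mu : probability (config I) R) (i : I') :
  is_product_measure nu' mu' -> nu' i [set false] = 0%E ->
  {ae (mu' \x mu)%E, forall w : config I' * config I, w.1 i}.
Proof.
move=> muP nu0; set F := cylinder [fset i]%fset (fun=> [set false]).
have muF : mu' F = 0%E by rewrite [LHS]muP big_seq_fset1.
exists (F `*` setT); split.
  by apply: measurableX => //; exact: measurable_cylinder.
  rewrite [LHS]product_measure1E //; last exact: measurable_cylinder.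
  by apply/eqP; rewrite mule_eq0; apply/orP; left; apply/eqP.
move=> w /= wi; split => // j; rewrite inE => /eqP ->.
exact/negbTE/negP.
Qed.

Section Pattern.
Variables (R : realType) (a : nat) (T : ended_tree a) (num : edge T -> nat).
Variables (N : genealogy a (@level _ T)) (up : T -> edge T).
Hypotheses (up_inj : injective up) (num_up : forall x, num (up x) = rank N x).
Variable k : nat.
Hypothesis ka : (k <= a)%N.

(** The child endpoints of all edges that the pattern prescribes, including those of rank above [k],
    which have to be closed. *)
Definition pattern_vertices (r : T) (n : nat) : seq T :=
  flatten [seq [seq child_at N y c | y <- desc N k r i, c <- iota 1 a]
          | i <- iota 0 n].

Lemma mem_pattern_vertices r n x : reflect
  (exists2 i, (i < n)%N & parent N x \in desc N k r i)
  (x \in pattern_vertices r n).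
Proof.
apply: (iffP flatten_mapP) => [[i]|[i ni xr]].
  rewrite mem_iota => ni /allpairsP[[y c] /= [yr]]; rewrite mem_iota => ca ->.
  by exists i; [lia|rewrite parent_child_at //; lia].
exists i; first by rewrite mem_iota; lia.
apply/allpairsP; exists (parent N x, rank N x); rewrite /= child_at_rank.
by split => //; rewrite mem_iota; have := rank_bounds N x; lia.
Qed.

Lemma size_pattern_vertices r n :
  size (pattern_vertices r n) = (\sum_(i <- iota 0 n) k ^ i * a)%N.
Proof.
rewrite size_flatten /shape -map_comp sumnE big_map; apply: eq_bigr => i _.
by rewrite /= size_allpairs size_desc size_iota.
Qed.

Definition pattern_edges r n : {fset edge T} :=
  seq_fset tt (map up (pattern_vertices r n)).

Lemma level_pattern_edges r n x : up x \in pattern_edges r n ->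
  level r < level x <= level r + n%:Z.
Proof.
rewrite seq_fsetE => /mapP[y + /up_inj ->] => /mem_pattern_vertices[i ni yr].
by have := lev_desc ka yr; rewrite lev_parent; lia.
Qed.

(** The child endpoints of the edges of a pattern lie at levels above [level r] and at most
    [level r + n]; such ranges of levels are disjoint here. *)
Lemma pattern_edges_disjoint r s n : level r + n%:Z <= level s ->
  [disjoint pattern_edges r n & pattern_edges s n]%fset.
Proof.
move=> rs; apply/fdisjointP => e er; apply/negP => es.
move: er (er); rewrite {1}seq_fsetE => /mapP[x _ ex]; rewrite ex in es *.
move=> /level_pattern_edges xr; have := level_pattern_edges es; lia.
Qed.

Lemma pattern_edges_pairwise_disjoint (r : nat -> T) n :
  (forall i j, (i < j)%N -> level (r i) + n%:Z <= level (r j) \/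
                            level (r j) + n%:Z <= level (r i)) ->
  forall i j, i != j ->
    [disjoint pattern_edges (r i) n & pattern_edges (r j) n]%fset.
Proof.
move=> sep i j; wlog ij : i j / (i < j)%N => [H|_].
  case: (ltngtP i j) => // ij _; last rewrite fdisjoint_sym; apply: H => //.
    by rewrite ltn_eqF.
  by rewrite ltn_eqF.
by case: (sep _ _ ij) => ?; last rewrite fdisjoint_sym; exact: pattern_edges_disjoint.
Qed.

(** The state required of [e] depends on its number only, so one family serves the patterns at all
    places. *)
Definition pattern (e : edge T) : set bool := [set (num e <= k)%N].

Lemma cylinder_pattern r n w : cylinder (pattern_edges r n) pattern w ->
  forall x i, (i < n)%N -> parent N x \in desc N k r i ->
  w (up x) = (rank N x <= k)%N.
Proof.
move=> wr x i ni xr; rewrite -num_up; apply: wr.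
rewrite seq_fsetE map_f //; apply/mem_pattern_vertices; by exists i.
Qed.

Variables (ao : nat) (p : R) (mu : probability (config (edge T)) R).
Hypotheses (p01 : 0 < p < 1) (ao_k : (ao <= k)%N).
Hypothesis muP : is_percolation num ao p mu.

(** Each prescribed state has probability 1, [p] or [1 - p]. The bound depends on [n] but not on
    [r], as the number of prescribed edges does. *)
Lemma pattern_prob_ge r n :
  ((Num.min p (1 - p) ^+ (\sum_(i <- iota 0 n) k ^ i * a))%:E
    <= mu (cylinder (pattern_edges r n) pattern))%E.
Proof.
have [p0 p1] := andP p01.
apply: (product_measure_cylinder_ge (muP : is_product_measure _ mu)).
- by apply/andP; split; [rewrite le_min; lra|rewrite ge_min; lra].
- move=> e _; rewrite [leRHS]bernoulli_prob_set1.
    rewrite lee_fin; case: ifP => ek; case: ifP => eo; rewrite ge_min; try lra.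
    by move: ek; rewrite (leq_trans eo).
  by case: ifP => _; lra.
- by rewrite -(size_pattern_vertices r) -(size_map up) size_seq_fset size_undup.
Qed.

End Pattern.

(** * Almost sure occurrence of the patterns, and conclusion *)

Theorem theorem3p1 (R : realType) (a' a ao' ao : nat) (p' p : R)
  (ha' : (1 <= a')%N) (ha : (1 <= a)%N)
  (hao' : (1 <= ao' <= a')%N) (hao : (1 <= ao <= a)%N)
  (hp' : 0 < p' < 1) (hp : 0 < p < 1)
  (T' : ended_tree a') (T : ended_tree a)
  (num' : edge T' -> nat) (num : edge T -> nat)
  (hnum' : is_numbering num') (hnum : is_numbering num)
  (mu' : probability (config (edge T')) R)
  (mu : probability (config (edge T)) R)
  (hmu' : is_percolation num' ao' p' mu')
  (hmu : is_percolation num ao p mu)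
  (hsupp : [set k | (ao' <= k <= a')%N] `&` [set k | (ao <= k <= a)%N] !=set0) :
  {ae (mu' \x mu)%E, forall w : config (edge T') * config (edge T),
    let H := DL_open w.1 w.2 in
    amenable (induced_subgraph (component (DL_root T' T : H))) R}.
Proof.
have [k [/= /andP[aok' ka'] /andP[aok ka]]] := hsupp.
have [ao'1 _] := andP hao'; have [ao1 _] := andP hao.
have [N' [up' [up'_inj num_up' open_adj']]] := ended_tree_genealogy hnum'.
have [N [up [up_inj num_up open_adj]]] := ended_tree_genealogy hnum.
have min_gt0 (q : R) : 0 < q < 1 -> 0 < Num.min q (1 - q).
  by move=> ?; rewrite lt_min; lra.
(* Levels may increase or decrease along each sequence of roots: they increase along first children
   and decrease along ancestors. *)
have patterns (r' : nat -> T') (r : nat -> T) n :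
    (forall i j, (i < j)%N -> level (r' i) + n%:Z <= level (r' j) \/
                              level (r' j) + n%:Z <= level (r' i)) ->
    (forall i j, (i < j)%N -> level (r i) + n%:Z <= level (r j) \/
                              level (r j) + n%:Z <= level (r i)) ->
    {ae (mu' \x mu)%E, forall w : config (edge T') * config (edge T), exists j,
      cylinder (pattern_edges N' up' k (r' j) n) (pattern num' k) w.1 /\
      cylinder (pattern_edges N up k (r j) n) (pattern num k) w.2}.
  move=> sep' sep; apply: (ae_exists_cylinder hmu' hmu
    (pattern_edges_pairwise_disjoint N' up'_inj ka' sep')
    (pattern_edges_pairwise_disjoint N up_inj ka sep) _ _
    (fun j => pattern_prob_ge N' up' hp' aok' hmu' (r' j) n)
    (fun j => pattern_prob_ge N up hp aok hmu (r j) n)).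
  - exact/exprn_gt0/min_gt0.
  - exact/exprn_gt0/min_gt0.
set o' := tree_root T'; set o := tree_root T.
(* The factor [n] spaces the roots by [n] levels. The extra [n] generations upwards make the levels
   of the two roots differ as a tetrahedron of height [n] requires. *)
have up_down : {ae (mu' \x mu)%E, forall w : config (edge T') * config (edge T),
    forall n, exists j,
      cylinder (pattern_edges N' up' k (iter (n * j + n) (parent N') o') n)
        (pattern num' k) w.1 /\
      cylinder (pattern_edges N up k (first_line N o (n * j)) n)
        (pattern num k) w.2}.
  apply/ae_foralln => n; apply: patterns => i j ij.
    by right; rewrite !lev_iter_parent; nia.
  by left; rewrite !lev_first_line //; nia.
have down_up : {ae (mu' \x mu)%E, forall w : config (edge T') * config (edge T),
    forall n, exists j,
      cylinder (pattern_edges N' up' k (first_line N' o' (n * j)) n)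
        (pattern num' k) w.1 /\
      cylinder (pattern_edges N up k (iter (n * j + n) (parent N) o) n)
        (pattern num k) w.2}.
  apply/ae_foralln => n; apply: patterns => i j ij.
    by left; rewrite !lev_first_line //; nia.
  by right; rewrite !lev_iter_parent; nia.
(* The first line consists of edges numbered 1, which is at most [ao'], so each is open with
   probability 1. *)
have line' : {ae (mu' \x mu)%E, forall w : config (edge T') * config (edge T),
    forall n, w.1 (up' (first_line N' o' n.+1))}.
  apply/ae_foralln => n; apply: (ae_product_fst _ hmu').
  by rewrite num_up' rank_first_line // ao'1; exact: bernoulli_prob1_false.
have line : {ae (mu' \x mu)%E, forall w : config (edge T') * config (edge T),
    forall n, w.2 (up (first_line N o n.+1))}.
  apply/ae_foralln => n; apply: (ae_product_snd _ hmu).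
  by rewrite num_up rank_first_line // ao1; exact: bernoulli_prob1_false.
(* On the intersection of the four almost sure events the deterministic criterion applies. *)
apply: filter_app line; apply: filter_app line'.
apply: filter_app up_down; apply: filter_app down_up.
apply: aeW => w down_up up_down line' line.
have k1 : (1 <= k)%N by exact: leq_trans aok.
apply: (DL_amenable (open_adj' w.1) (open_adj w.2) R k1 ka' ka) => // n _.
  have [j [w'j wj]] := up_down n; exists (n * j)%N; split.
    exact: (cylinder_pattern num_up' ka' w'j).
  exact: (cylinder_pattern num_up ka wj).
have [j [w'j wj]] := down_up n; exists (n * j)%N; split.
  exact: (cylinder_pattern num_up' ka' w'j).
exact: (cylinder_pattern num_up ka wj).
Qed.
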